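(* Let $A_L(\eta), A_R(\eta) \in \mathbb{R}^{n \times n}$ and $b(\eta) \in \mathbb{R}^n$ vary continuously with a parameter $\eta \in \mathbb{R}$, with $A_L(\eta)$ and $A_R(\eta)$ differing only in their first columns for every $\eta$, and consider the family of piecewise-linear maps $$f(x) = \begin{cases} A_L x + b, & x_1 \le 0, \\ A_R x + b, & x_1 \ge 0. \end{cases}$$ Let $\mathcal{X} = \mathcal{F}[\ell,m,p]$, let $d$ be the multiplicative inverse of $m$ modulo $p$, and let $k = jd$ where $j \in \{0, \ell-1, \ell, p-1\}$. Suppose the $\mathcal{X}$-cycle undergoes a border-collision bifurcation (BCB) at $\eta = \eta^*$ by the collision of its $k$-th point (index taken modulo $p$) with the switching manifold $x_1 = 0$. Suppose this BCB is generic in the sense that $\det(I - M_{\mathcal{X}})$, $\det(I - M_{\mathcal{X}^{\overline{k}}})$ and $\varrho^{\mathsf{T}} b$ are all nonzero at $\eta = \eta^*$, and that the $\mathcal{X}$-cycle and the $\mathcal{X}^{\overline{k}}$-cycle are each admissible on exactly one side of the bifurcation. Then the BCB at $\eta = \eta^*$ is a nonsmooth fold.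
   Context: Words. Let $\Omega = \{L,R\}$. A word of length $p$ is an element $\mathcal{X} = \mathcal{X}_0 \cdots \mathcal{X}_{p-1} \in \Omega^p$. For $k \in \mathbb{Z}$, $\mathcal{X}^{\overline{k}}$ is the word identical to $\mathcal{X}$ except in its $i$-th symbol, where $i = k \bmod p$ (that symbol is switched between $L$ and $R$). For positive integers $\ell, m, p$ with $\ell < p$, $m < p$ and $\gcd(m,p) = 1$, the word $\mathcal{F}[\ell,m,p] \in \Omega^p$ is defined by $\mathcal{F}_i = L$ if $(im \bmod p) < \ell$, and $\mathcal{F}_i = R$ otherwise, for $i = 0,\ldots,p-1$. The multiplicative inverse of $m$ modulo $p$ is the unique $d \in \{1,\ldots,p-1\}$ with $md \bmod p = 1$. Cycles. Write $f_L(x) = A_L x + b$ and $f_R(x) = A_R x + b$. An $\mathcal{X}$-cycle is an ordered set $\{y^{(0)},\ldots,y^{(p-1)}\}$ of points in $\mathbb{R}^n$ with $f_{\mathcal{X}_i}(y^{(i)}) = y^{((i+1) \bmod p)}$ for $i = 0,\ldots,p-1$; $y^{(i)}$ is called its $i$-th point. It is admissible if $y^{(i)}_1 < 0$ for all $i$ with $\mathcal{X}_i = L$ and $y^{(i)}_1 > 0$ for all $i$ with $\mathcal{X}_i = R$. It is virtual if $y^{(i)}_1 > 0$ for some $i$ with $\mathcal{X}_i = L$ or $y^{(i)}_1 < 0$ for some $i$ with $\mathcal{X}_i = R$. Let $M_{\mathcal{X}} = A_{\mathcal{X}_{p-1}} \cdots A_{\mathcal{X}_1} A_{\mathcal{X}_0}$;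 the $\mathcal{X}$-cycle exists and is unique if and only if $\det(I - M_{\mathcal{X}}) \ne 0$. The vector $\varrho^{\mathsf{T}}$ is the first row of the adjugate matrix $\mathrm{adj}(I - A_L)$ (equivalently of $\mathrm{adj}(I - A_R)$). Bifurcation. That the $\mathcal{X}$-cycle undergoes a BCB at $\eta = \eta^*$ by collision of its $k$-th point with the switching manifold means that, at $\eta = \eta^*$, the $k$-th point $y^{(k \bmod p)}$ of the $\mathcal{X}$-cycle satisfies $y^{(k \bmod p)}_1 = 0$ and it is the only point of the cycle on the switching manifold. Under the nonvanishing determinant assumptions, the $\mathcal{X}$-cycle and the $\mathcal{X}^{\overline{k}}$-cycle exist, are unique and vary continuously for $\eta$ near $\eta^*$, and they coincide at $\eta = \eta^*$. The two sides of the bifurcation are $\eta < \eta^*$ and $\eta > \eta^*$, with $\eta$ in a sufficiently small neighbourhood of $\eta^*$. A cycle being admissible on exactly one side means it is admissible for all such $\eta$ on one side and virtual for all such $\eta$ on the other side. The BCB is called persistence if the $\mathcal{X}$-cycle and $\mathcal{X}^{\overline{k}}$-cycle are admissible on different sides of the bifurcation, and a nonsmooth fold if they are admissible on the same side. *)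

(* Defs.v *)
From HB Require Import structures.
From mathcomp Require Import all_boot all_order all_algebra.
From mathcomp Require Import all_classical all_reals all_analysis.
Set Implicit Arguments.
Unset Strict Implicit.
Unset Printing Implicit Defensive.
Import Order.TTheory GRing.Theory Num.Theory.
Import numFieldNormedType.Exports.
Local Open Scope classical_set_scope.
Local Open Scope ring_scope.

Inductive letter := symL | symR.

Definition switch (s : letter) : letter :=
  match s with symL => symR | symR => symL end.

Definition word (p : nat) := {ffun 'I_p -> letter}.

Definition flip (p : nat) (X : word p) (k : int) : word p :=
  [ffun i : 'I_p => if (i%:Z == (k %% p%:Z)%Z) then switch (X i) else X i].

Definition rotational_word (ell m p : nat) : word p :=
  [ffun i : 'I_p => if ((i * m) %% p < ell)%N then symL else symR].

Definition letter_mx (R : realType) (n : nat) (AL AR : 'M[R]_n.+1)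
    (s : letter) : 'M[R]_n.+1 :=
  match s with symL => AL | symR => AR end.

Definition branch (R : realType) (n : nat) (AL AR : 'M[R]_n.+1)
    (b : 'cV[R]_n.+1) (s : letter) (x : 'cV[R]_n.+1) : 'cV[R]_n.+1 :=
  letter_mx AL AR s *m x + b.

Definition differ_only_in_first_column (R : realType) (n : nat)
    (AL AR : 'M[R]_n.+1) : Prop :=
  forall i j : 'I_n.+1, j != ord0 -> AL i j = AR i j.

Definition coord1 (R : realType) (n : nat) (x : 'cV[R]_n.+1) : R :=
  x ord0 ord0.

(* The two pieces of the map agree on the overlap [coord1 x = 0] when the
   matrices differ only in their first columns (see [pwl_mapE]). *)
Definition pwl_map (R : realType) (n : nat) (AL AR : 'M[R]_n.+1)
    (b x : 'cV[R]_n.+1) : 'cV[R]_n.+1 :=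
  if coord1 x <= 0 then AL *m x + b else AR *m x + b.

(* The points of a cycle need not be distinct.  [ordS] is the cyclic successor
   i |-> (i + 1) mod p on ['I_p]. *)
Definition is_cycle (R : realType) (n p : nat) (AL AR : 'M[R]_n.+1)
    (b : 'cV[R]_n.+1) (X : word p) (y : 'I_p -> 'cV[R]_n.+1) : Prop :=
  forall i : 'I_p, branch AL AR b (X i) (y i) = y (ordS i).

Definition admissible (R : realType) (n p : nat) (X : word p)
    (y : 'I_p -> 'cV[R]_n.+1) : Prop :=
  forall i : 'I_p, (X i = symL -> coord1 (y i) < 0) /\
                   (X i = symR -> 0 < coord1 (y i)).

Definition virtual (R : realType) (n p : nat) (X : word p)
    (y : 'I_p -> 'cV[R]_n.+1) : Prop :=
  exists i : 'I_p, (X i = symL /\ 0 < coord1 (y i)) \/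
                   (X i = symR /\ coord1 (y i) < 0).

(* A_{X_{p-1}} ... A_{X_1} A_{X_0}: [rev_ord] puts the last letter leftmost. *)
Definition word_mx (R : realType) (n p : nat) (AL AR : 'M[R]_n.+1)
    (X : word p) : 'M[R]_n.+1 :=
  \prod_(i < p) letter_mx AL AR (X (rev_ord i)).

Definition varrho (R : realType) (n : nat) (A : 'M[R]_n.+1) : 'rV[R]_n.+1 :=
  row ord0 (\adj (1%:M - A)).

(* When det (I - M_X) != 0 the X-cycle is unique, so the existential
   quantifiers over cycles below speak of "the" X-cycle. *)
Definition cycle_admissible (R : realType) (n p : nat) (AL AR : 'M[R]_n.+1)
    (b : 'cV[R]_n.+1) (X : word p) : Prop :=
  exists2 y, is_cycle AL AR b X y & admissible X y.

Definition cycle_virtual (R : realType) (n p : nat) (AL AR : 'M[R]_n.+1)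
    (b : 'cV[R]_n.+1) (X : word p) : Prop :=
  exists2 y, is_cycle AL AR b X y & virtual X y.

Inductive bif_side := below | above.

Definition opposite (s : bif_side) : bif_side :=
  match s with below => above | above => below end.

Definition side_nbhs (R : realType) (eta0 : R) (s : bif_side) : set_system R :=
  match s with below => eta0^'- | above => eta0^'+ end.

Definition admissible_exactly_on (R : realType) (n p : nat)
    (AL AR : R -> 'M[R]_n.+1) (b : R -> 'cV[R]_n.+1) (eta0 : R)
    (X : word p) (s : bif_side) : Prop :=
  (\forall eta \near side_nbhs eta0 s,
     cycle_admissible (AL eta) (AR eta) (b eta) X) /\
  (\forall eta \near side_nbhs eta0 (opposite s),
     cycle_virtual (AL eta) (AR eta) (b eta) X).

Definition admissible_on_exactly_one_side (R : realType) (n p : nat)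
    (AL AR : R -> 'M[R]_n.+1) (b : R -> 'cV[R]_n.+1) (eta0 : R)
    (X : word p) : Prop :=
  exists s : bif_side, admissible_exactly_on AL AR b eta0 X s.

Definition undergoes_BCB (R : realType) (n p : nat)
    (AL AR : R -> 'M[R]_n.+1) (b : R -> 'cV[R]_n.+1) (eta0 : R)
    (X : word p) (k : int) : Prop :=
  exists2 y, is_cycle (AL eta0) (AR eta0) (b eta0) X y &
    forall i : 'I_p, coord1 (y i) = 0 <-> i%:Z = (k %% p%:Z)%Z.

Definition generic_BCB (R : realType) (n p : nat)
    (AL AR : R -> 'M[R]_n.+1) (b : R -> 'cV[R]_n.+1) (eta0 : R)
    (X : word p) (k : int) : Prop :=
  [/\ \det (1%:M - word_mx (AL eta0) (AR eta0) X) != 0,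
      \det (1%:M - word_mx (AL eta0) (AR eta0) (flip X k)) != 0,
      (varrho (AL eta0) *m b eta0) ord0 ord0 != 0,
      admissible_on_exactly_one_side AL AR b eta0 X &
      admissible_on_exactly_one_side AL AR b eta0 (flip X k)].

Definition persistence (R : realType) (n p : nat)
    (AL AR : R -> 'M[R]_n.+1) (b : R -> 'cV[R]_n.+1) (eta0 : R)
    (X : word p) (k : int) : Prop :=
  exists s : bif_side, admissible_exactly_on AL AR b eta0 X s /\
    admissible_exactly_on AL AR b eta0 (flip X k) (opposite s).

Definition nonsmooth_fold (R : realType) (n p : nat)
    (AL AR : R -> 'M[R]_n.+1) (b : R -> 'cV[R]_n.+1) (eta0 : R)
    (X : word p) (k : int) : Prop :=
  exists s : bif_side, admissible_exactly_on AL AR b eta0 X s /\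
    admissible_exactly_on AL AR b eta0 (flip X k) s.

Lemma pwl_mapE (R : realType) (n : nat) (AL AR : 'M[R]_n.+1)
    (b x : 'cV[R]_n.+1) :
  differ_only_in_first_column AL AR -> 0 <= coord1 x ->
  pwl_map AL AR b x = AR *m x + b.
Proof.
move=> hA hx; rewrite /pwl_map; case: ifP => // hx'.
have x0 : x ord0 ord0 = 0 by apply/eqP; rewrite eq_le; apply/andP.
congr (_ + _); apply/matrixP => i j; rewrite !mxE ord1.
apply: eq_bigr => l _; have [->|ln0] := eqVneq l ord0.
  by rewrite x0 !mulr0.
by rewrite hA.
Qed.

Lemma admissible_cycle_pwl_map (R : realType) (n p : nat)
    (AL AR : 'M[R]_n.+1) (b : 'cV[R]_n.+1) (X : word p)
    (y : 'I_p -> 'cV[R]_n.+1) :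
  is_cycle AL AR b X y -> admissible X y ->
  forall i, pwl_map AL AR b (y i) = y (ordS i).
Proof.
move=> cy ay i; rewrite -cy /pwl_map /branch.
case: (X i) (ay i) => /= -[hL hR]; first by rewrite ltW ?hL.
by rewrite leNgt hR.
Qed.

(* Main.v *)
Require Import Defs.
From HB Require Import structures.
From mathcomp Require Import all_boot all_order all_algebra.
From mathcomp Require Import all_classical all_reals all_analysis.
From mathcomp Require Import ring zify.
Set Implicit Arguments.
Unset Strict Implicit.
Unset Printing Implicit Defensive.
Import Order.TTheory GRing.Theory Num.Theory.
Import numFieldNormedType.Exports.
Local Open Scope classical_set_scope.
Local Open Scope ring_scope.

(** Write [D X = det (I - M_X)] and [X' = flip X k].  If [y] is an [X]-cycle and
    [w] an [X']-cycle, then Cramer's rule at the [k]-th point gives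
    [D X * y_k = D X' * w_k] for the first coordinates, because the two linear
    systems differ only in the first column of their matrices.  Hence the
    bifurcation is a nonsmooth fold as soon as [D X] and [D X'] have opposite
    signs.  For a rotational word and the four given values of [j] there is an
    index [k' != k] such that switching the [k']-th letter of [X'] yields a
    cyclic shift of [X].  At [eta0] the [X]-cycle [y] is also an [X']-cycle,
    while its shift [i |-> y_(i+s)] is a cycle of the switched word, whose
    determinant is again [D X].  The same identity at [k'] reads
    [D X' * y_k' = D X * y_(k'+s)], and since [X] has opposite letters at [k']
    and [k'+s] these two coordinates have opposite signs. *)

(** * Determinant and adjugate identities *)

(** Sylvester's identity: the block matrix with rows [1, A] and [B, 1] factors into block triangular
    matrices in two ways. *)
Lemma det_sub1_mulmxC (R : comNzRingType) (n : nat) (A B : 'M[R]_n) :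
  \det (1%:M - A *m B) = \det (1%:M - B *m A).
Proof.
have e1 : block_mx 1%:M A B 1%:M
    = block_mx 1%:M 0 B 1%:M *m block_mx 1%:M A 0 (1%:M - B *m A).
  by rewrite mulmx_block !mul1mx !mulmx1 !mul0mx !addr0 addrC subrK.
have e2 : block_mx 1%:M A B 1%:M
    = block_mx (1%:M - A *m B) A 0 1%:M *m block_mx 1%:M 0 B 1%:M.
  by rewrite mulmx_block !mul1mx !mulmx1 !mul0mx !mulmx0 !add0r subrK.
have := congr1 determinant e1; rewrite {1}e2 !det_mulmx.
by rewrite !det_ublock !det_lblock !det1 !mul1r !mulr1.
Qed.

(** The first row of the adjugate consists of the cofactors along the first column, and these delete
    that column. *)
Lemma adj_row0_first_column (R : comNzRingType) (n : nat) (A B : 'M[R]_n.+1)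
    (i : 'I_n.+1) :
  (forall i' j, j != ord0 -> A i' j = B i' j) ->
  \adj A ord0 i = \adj B ord0 i.
Proof.
move=> hAB; rewrite !mxE; congr (_ * \det _).
by apply/matrixP => i' j'; rewrite !mxE hAB // eq_sym neq_lift.
Qed.

Lemma det_coord1 (R : realType) (n : nat) (A : 'M[R]_n.+1)
    (x g : 'cV[R]_n.+1) :
  A *m x = g -> \det A * coord1 x = coord1 (\adj A *m g).
Proof. by move=> <-; rewrite mulmxA mul_adj_mx mul_scalar_mx /coord1 mxE. Qed.

(** * Return maps along an itinerary and Cramer's rule *)

(** [itin_mx] and [itin_vec] are the linear and the translation part of the composition of the first
    [t] branches. The sequence [S] is infinite, so its indices need no reduction modulo a length. *)
Fixpoint itin_mx (R : realType) (n : nat) (AL AR : 'M[R]_n.+1)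
    (S : nat -> letter) (t : nat) : 'M[R]_n.+1 :=
  if t is t'.+1 then letter_mx AL AR (S t') *m itin_mx AL AR S t' else 1%:M.

Fixpoint itin_vec (R : realType) (n : nat) (AL AR : 'M[R]_n.+1)
    (b : 'cV[R]_n.+1) (S : nat -> letter) (t : nat) : 'cV[R]_n.+1 :=
  if t is t'.+1 then branch AL AR b (S t') (itin_vec AL AR b S t') else 0.

Lemma itin_mxS (R : realType) (n : nat) (AL AR : 'M[R]_n.+1)
    (S : nat -> letter) (t : nat) :
  itin_mx AL AR S t.+1
  = itin_mx AL AR (fun u => S u.+1) t *m letter_mx AL AR (S 0).
Proof.
elim: t => [|t IH]; first by rewrite /= mulmx1 mul1mx.
by rewrite -[LHS]/(letter_mx AL AR (S t.+1) *m itin_mx AL AR S t.+1) IH mulmxA.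
Qed.

(** The first branch sends 0 to [b] whatever its letter, so [S 0] does not occur on the right. *)
Lemma itin_vecS (R : realType) (n : nat) (AL AR : 'M[R]_n.+1)
    (b : 'cV[R]_n.+1) (S : nat -> letter) (t : nat) :
  itin_vec AL AR b S t.+1 = itin_mx AL AR (fun u => S u.+1) t *m b
                            + itin_vec AL AR b (fun u => S u.+1) t.
Proof.
elim: t => [|t IH]; first by rewrite /= /branch mulmx0 mul1mx addrC.
rewrite -[LHS]/(branch AL AR b (S t.+1) (itin_vec AL AR b S t.+1)) IH.
by rewrite /branch /= mulmxDr mulmxA addrA.
Qed.

Lemma eq_itin_mx (R : realType) (n : nat) (AL AR : 'M[R]_n.+1)
    (S T : nat -> letter) (t : nat) :
  (forall u, (u < t)%N -> S u = T u) -> itin_mx AL AR S t = itin_mx AL AR T t.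
Proof.
elim: t => //= t IH h; rewrite h // IH // => u ut; exact/h/ltnW.
Qed.

Lemma eq_itin_vec (R : realType) (n : nat) (AL AR : 'M[R]_n.+1)
    (b : 'cV[R]_n.+1) (S T : nat -> letter) (t : nat) :
  (forall u, (u < t)%N -> S u = T u) ->
  itin_vec AL AR b S t = itin_vec AL AR b T t.
Proof.
elim: t => //= t IH h; rewrite h // IH // => u ut; exact/h/ltnW.
Qed.

Definition itin (q : nat) (X : word q.+1) (i : 'I_q.+1) (t : nat) : letter :=
  X (inZp (i + t)).

(** The matrix of the fixed-point equation of the return map at place [i], which the [i]-th point of
    a cycle solves. *)
Definition lap_mx (R : realType) (n q : nat) (AL AR : 'M[R]_n.+1)
    (X : word q.+1) (i : 'I_q.+1) : 'M[R]_n.+1 :=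
  1%:M - itin_mx AL AR (itin X i) q.+1.

(** Cramer's numerator: the determinant of [lap_mx] with its first column replaced by the
    translation part. *)
Definition cramer_num (R : realType) (n q : nat) (AL AR : 'M[R]_n.+1)
    (b : 'cV[R]_n.+1) (X : word q.+1) (i : 'I_q.+1) : R :=
  coord1 (\adj (lap_mx AL AR X i) *m itin_vec AL AR b (itin X i) q.+1).

Lemma word_mxE (R : realType) (n q : nat) (AL AR : 'M[R]_n.+1)
    (X : word q.+1) :
  word_mx AL AR X = itin_mx AL AR (itin X ord0) q.+1.
Proof.
have aux t (S : nat -> letter) :
    \prod_(i < t) letter_mx AL AR (S (rev_ord i)) = itin_mx AL AR S t.
  elim: t => [|t IH]; first by rewrite big_ord0.
  rewrite big_ord_recl [RHS]/= -IH; congr (letter_mx _ _ (S _) *m _).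
  by rewrite /= subn1.
rewrite -aux /word_mx; apply: eq_bigr => i _; rewrite /itin add0n.
by rewrite valZpK.
Qed.

(** Starting one place later moves the first factor of the product to its other end, so
    [det_sub1_mulmxC] applies. *)
Lemma lap_det_ordS (R : realType) (n q : nat) (AL AR : 'M[R]_n.+1)
    (X : word q.+1) (i : 'I_q.+1) :
  \det (lap_mx AL AR X (ordS i)) = \det (lap_mx AL AR X i).
Proof.
rewrite /lap_mx [in RHS]itin_mxS /= -[in RHS]det_sub1_mulmxC.
have shiftS u : itin X (ordS i) u = itin X i u.+1.
  by rewrite /itin; congr (X _); apply: val_inj; rewrite /= modnDml addSnnS.
rewrite (@eq_itin_mx _ _ _ _ (itin X (ordS i)) (fun u => itin X i u.+1) q);
  last by move=> u _.
congr (\det (_ - letter_mx _ _ _ *m _)).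
rewrite shiftS /itin; congr (X _); apply: val_inj => /=.
by rewrite modnDr addn0.
Qed.

Lemma lap_det_const (R : realType) (n q : nat) (AL AR : 'M[R]_n.+1)
    (X : word q.+1) (i : 'I_q.+1) :
  \det (lap_mx AL AR X i) = \det (1%:M - word_mx AL AR X).
Proof.
rewrite word_mxE -/(lap_mx AL AR X ord0).
suff H t : \det (lap_mx AL AR X (inZp t)) = \det (lap_mx AL AR X ord0).
  by rewrite -[i]valZpK H.
elim: t => [|t <-]; first by congr (\det (lap_mx _ _ _ _)); apply: val_inj.
rewrite -[RHS]lap_det_ordS; congr (\det (lap_mx _ _ _ _)); apply: val_inj => /=.
by rewrite -addn1 -[in RHS]addn1 modnDml.
Qed.

Lemma cycle_itin (R : realType) (n q : nat) (AL AR : 'M[R]_n.+1)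
    (b : 'cV[R]_n.+1) (X : word q.+1) (y : 'I_q.+1 -> 'cV[R]_n.+1)
    (i : 'I_q.+1) (t : nat) :
  is_cycle AL AR b X y ->
  y (inZp (i + t)) = itin_mx AL AR (itin X i) t *m y i
                     + itin_vec AL AR b (itin X i) t.
Proof.
move=> hy; elim: t => [|t IH]; first by rewrite addn0 valZpK mul1mx addr0.
have -> : inZp (i + t.+1) = ordS (inZp (i + t)) :> 'I_q.+1.
  by apply: val_inj; rewrite /= addnS -addn1 -modnDml addn1.
by rewrite -hy /branch IH /= /branch mulmxDr mulmxA addrA.
Qed.

Lemma cycle_cramer (R : realType) (n q : nat) (AL AR : 'M[R]_n.+1)
    (b : 'cV[R]_n.+1) (X : word q.+1) (y : 'I_q.+1 -> 'cV[R]_n.+1)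
    (i : 'I_q.+1) :
  is_cycle AL AR b X y ->
  \det (1%:M - word_mx AL AR X) * coord1 (y i) = cramer_num AL AR b X i.
Proof.
move=> hy; rewrite -(lap_det_const _ _ _ i); apply: det_coord1.
have := cycle_itin i q.+1 hy.
have -> : inZp (i + q.+1) = i.
  by apply: val_inj; rewrite /= modnDr modn_small.
by move=> e; apply/eqP; rewrite /lap_mx mulmxBl mul1mx subr_eq addrC -e.
Qed.

(* Going once around the cycle from its [i]-th point, the letter [X i] is used
   first, so changing it only changes the first column of [lap_mx] and does
   not change the translation part of the return map. *)
Lemma cramer_num_switch (R : realType) (n q : nat) (AL AR : 'M[R]_n.+1)
    (b : 'cV[R]_n.+1) (X Y : word q.+1) (i : 'I_q.+1) :
  differ_only_in_first_column AL AR ->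
  (forall j, j != i -> X j = Y j) ->
  cramer_num AL AR b X i = cramer_num AL AR b Y i.
Proof.
move=> hA hXY.
have hS u : (u < q)%N -> itin X i u.+1 = itin Y i u.+1.
  move=> uq; apply: hXY; apply/eqP => /(congr1 val) /= e.
  have : (i + u.+1 = i + 0 %[mod q.+1])%N by rewrite addn0 e modn_small.
  by move/eqP; rewrite eqn_modDl mod0n modn_small.
have hcol (s t : letter) i' j : j != ord0 ->
    letter_mx AL AR s i' j = letter_mx AL AR t i' j.
  by case: s t => [] [] //= j0; rewrite hA.
rewrite /cramer_num !itin_vecS (eq_itin_mx _ _ hS).
rewrite (eq_itin_vec _ _ _ hS) /coord1 !mxE.
apply: eq_bigr => k _; congr (_ * _); apply: adj_row0_first_column => i' j j0.
rewrite /lap_mx !itin_mxS (eq_itin_mx _ _ hS) !mxE.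
by congr (_ - _); apply: eq_bigr => l _; congr (_ * _); apply: hcol.
Qed.

Lemma switched_cycles (R : realType) (n q : nat) (AL AR : 'M[R]_n.+1)
    (b : 'cV[R]_n.+1) (X Y : word q.+1) (y w : 'I_q.+1 -> 'cV[R]_n.+1)
    (i : 'I_q.+1) :
  differ_only_in_first_column AL AR ->
  (forall j, j != i -> X j = Y j) ->
  is_cycle AL AR b X y -> is_cycle AL AR b Y w ->
  \det (1%:M - word_mx AL AR X) * coord1 (y i)
  = \det (1%:M - word_mx AL AR Y) * coord1 (w i).
Proof.
move=> hA hXY hy hw.
by rewrite (cycle_cramer _ hy)
  (cycle_cramer _ hw) (cramer_num_switch _ hA hXY).
Qed.

(** * Cyclic shifts and switched letters *)

Definition shift (q : nat) (X : word q.+1) (s : 'I_q.+1) : word q.+1 :=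
  [ffun i => X (i + s)].

(** A lap of the shifted word from place 0 is a lap of [X] from place [s], and all laps have the
    same determinant. *)
Lemma det_shift (R : realType) (n q : nat) (AL AR : 'M[R]_n.+1)
    (X : word q.+1) (s : 'I_q.+1) :
  \det (1%:M - word_mx AL AR (shift X s)) = \det (1%:M - word_mx AL AR X).
Proof.
rewrite -(lap_det_const _ _ X s) word_mxE /lap_mx.
congr (\det (_ - _)); apply: eq_itin_mx => u _.
rewrite /itin ffunE; congr (X _); apply: val_inj => /=.
by rewrite modnDml add0n addnC.
Qed.

Lemma cycle_shift (R : realType) (n q : nat) (AL AR : 'M[R]_n.+1)
    (b : 'cV[R]_n.+1) (X : word q.+1) (y : 'I_q.+1 -> 'cV[R]_n.+1)
    (s : 'I_q.+1) :
  is_cycle AL AR b X y -> is_cycle AL AR b (shift X s) (fun i => y (i + s)).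
Proof.
move=> hy i; rewrite ffunE hy; congr (y _); apply: val_inj => /=.
by rewrite modnDml -[in LHS]addn1 modnDml addn1 addSn.
Qed.

(** The two branches agree where the first coordinate vanishes. *)
Lemma cycle_switch (R : realType) (n q : nat) (AL AR : 'M[R]_n.+1)
    (b : 'cV[R]_n.+1) (X Y : word q.+1) (y : 'I_q.+1 -> 'cV[R]_n.+1)
    (i : 'I_q.+1) :
  differ_only_in_first_column AL AR ->
  (forall j, j != i -> X j = Y j) -> coord1 (y i) = 0 ->
  is_cycle AL AR b X y -> is_cycle AL AR b Y y.
Proof.
move=> hA hXY y0 hy l; have [->|/hXY <-] := eqVneq l i; last exact: hy.
rewrite -hy /branch; congr (_ + _); apply/matrixP => r c.
rewrite !mxE ord1; apply: eq_bigr => k _.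
have [->|k0] := eqVneq k ord0; first by rewrite [y i _ _]y0 !mulr0.
by case: (X i) (Y i) => [] [] //=; rewrite hA.
Qed.

(** * Continuity in the parameter *)

(** Continuity is taken entrywise, so that it also covers empty matrices, which can occur as
    minors. *)
Definition mx_continuous (R : realType) (m n : nat) (M : R -> 'M[R]_(m, n)) :=
  forall i j, continuous (fun x => M x i j).

Lemma continuous_mx_continuous (R : realType) (m n : nat)
    (M : R -> 'M[R]_(m.+1, n.+1)) : continuous M -> mx_continuous M.
Proof.
move=> hM i j x.
exact: (continuous_comp (hM x) (@coord_continuous _ _ _ i j (M x))).
Qed.

Lemma mx_continuous_mul (R : realType) (m n l : nat) (M : R -> 'M[R]_(m, n))
    (N : R -> 'M[R]_(n, l)) :
  mx_continuous M -> mx_continuous N -> mx_continuous (fun x => M x *m N x).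
Proof.
move=> hM hN i j; under eq_fun do rewrite mxE.
apply: continuous_big; first exact: add_continuous.
by move=> k _ x; apply: cvgM; [exact: hM|exact: hN].
Qed.

Lemma mx_continuous_add (R : realType) (m n : nat) (M N : R -> 'M[R]_(m, n)) :
  mx_continuous M -> mx_continuous N -> mx_continuous (fun x => M x + N x).
Proof.
move=> hM hN i j; under eq_fun do rewrite mxE.
by move=> x; apply: cvgD; [exact: hM|exact: hN].
Qed.

Lemma mx_continuous_opp (R : realType) (m n : nat) (M : R -> 'M[R]_(m, n)) :
  mx_continuous M -> mx_continuous (fun x => - M x).
Proof.
move=> hM i j; under eq_fun do rewrite mxE.
by move=> x; apply: cvgN; exact: hM.
Qed.

Lemma mx_continuous_cst (R : realType) (m n : nat) (M : 'M[R]_(m, n)) :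
  mx_continuous (fun=> M).
Proof. by move=> i j x; apply: cvg_cst. Qed.

Lemma continuous_det (R : realType) (n : nat) (M : R -> 'M[R]_n) :
  mx_continuous M -> continuous (fun x => \det (M x)).
Proof.
move=> hM; rewrite /determinant.
apply: continuous_big; first exact: add_continuous.
move=> s _ x; apply: cvgM; first exact: cvg_cst.
move: x; apply: continuous_big; first exact: mul_continuous.
by move=> i _; exact: hM.
Qed.

Lemma mx_continuous_adj (R : realType) (n : nat) (M : R -> 'M[R]_n) :
  mx_continuous M -> mx_continuous (fun x => \adj (M x)).
Proof.
move=> hM i j; under eq_fun do rewrite mxE.
move=> x; apply: cvgM; first exact: cvg_cst.
move: x; apply: continuous_det => i' j'; under eq_fun do rewrite !mxE.
exact: hM.
Qed.

Lemma mx_continuous_itin_mx (R : realType) (n : nat) (AL AR : R -> 'M[R]_n.+1)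
    (S : nat -> letter) (t : nat) :
  mx_continuous AL -> mx_continuous AR ->
  mx_continuous (fun x => itin_mx (AL x) (AR x) S t).
Proof.
move=> hL hR; elim: t => [|t IH]; first exact: mx_continuous_cst.
by apply: mx_continuous_mul => //; case: (S t).
Qed.

Lemma mx_continuous_itin_vec (R : realType) (n : nat)
    (AL AR : R -> 'M[R]_n.+1) (b : R -> 'cV[R]_n.+1)
    (S : nat -> letter) (t : nat) :
  mx_continuous AL -> mx_continuous AR -> mx_continuous b ->
  mx_continuous (fun x => itin_vec (AL x) (AR x) (b x) S t).
Proof.
move=> hL hR hb; elim: t => [|t IH]; first exact: mx_continuous_cst.
by apply: mx_continuous_add => //; apply: mx_continuous_mul => //; case: (S t).
Qed.

Lemma continuous_word_det (R : realType) (n q : nat) (AL AR : R -> 'M[R]_n.+1)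
    (X : word q.+1) :
  mx_continuous AL -> mx_continuous AR ->
  continuous (fun x => \det (1%:M - word_mx (AL x) (AR x) X)).
Proof.
move=> hL hR; apply: continuous_det.
apply: mx_continuous_add; first exact: mx_continuous_cst.
apply: mx_continuous_opp; under eq_fun do rewrite word_mxE.
exact: mx_continuous_itin_mx.
Qed.

Lemma continuous_cramer_num (R : realType) (n q : nat)
    (AL AR : R -> 'M[R]_n.+1) (b : R -> 'cV[R]_n.+1) (X : word q.+1)
    (i : 'I_q.+1) :
  mx_continuous AL -> mx_continuous AR -> mx_continuous b ->
  continuous (fun x => cramer_num (AL x) (AR x) (b x) X i).
Proof.
move=> hL hR hb; apply: mx_continuous_mul.
  apply/mx_continuous_adj/mx_continuous_add; first exact: mx_continuous_cst.
  exact/mx_continuous_opp/mx_continuous_itin_mx.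
exact: mx_continuous_itin_vec.
Qed.

(** With determinant [D] and Cramer numerator [N], the product [D * N] is [D ^+ 2] times the
    coordinate. It is continuous and carries the sign of the coordinate, so no continuous choice of
    cycles has to be made. *)
Lemma cycle_coord1_sign_near (R : realType) (n q : nat)
    (AL AR : R -> 'M[R]_n.+1) (b : R -> 'cV[R]_n.+1) (X : word q.+1)
    (eta0 c : R) (y : 'I_q.+1 -> 'cV[R]_n.+1) (i : 'I_q.+1) :
  mx_continuous AL -> mx_continuous AR -> mx_continuous b ->
  \det (1%:M - word_mx (AL eta0) (AR eta0) X) != 0 ->
  is_cycle (AL eta0) (AR eta0) (b eta0) X y ->
  0 < c * coord1 (y i) ->
  \forall eta \near eta0, forall w,
    is_cycle (AL eta) (AR eta) (b eta) X w -> 0 < c * coord1 (w i).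
Proof.
move=> hL hR hb hdet hy hpos.
set D := fun x => \det (1%:M - word_mx (AL x) (AR x) X).
set N := fun x => cramer_num (AL x) (AR x) (b x) X i.
have eqDN x w : is_cycle (AL x) (AR x) (b x) X w ->
    c * (D x * N x) = D x ^+ 2 * (c * coord1 (w i)).
  move=> hw; rewrite /N -(cycle_cramer i hw) -/(D x).
  by rewrite mulrCA [c * (D x * _)]mulrCA mulrA -expr2.
have cont : {for eta0, continuous (fun x => c * (D x * N x))}.
  apply: cvgM; first exact: cvg_cst.
  apply: cvgM; [exact: continuous_word_det|exact: continuous_cramer_num].
have pos : 0 < c * (D eta0 * N eta0).
  by rewrite (eqDN _ _ hy) mulr_gt0 // exprn_even_gt0 //= hdet.
apply: filterS (cvgr_gt _ cont _ pos) => x hx w hw; move: hx.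
rewrite (eqDN _ _ hw) => hx; rewrite ltNge; apply/negP => hle.
by have := mulr_ge0_le0 (sqr_ge0 (D x)) hle; rewrite leNgt hx.
Qed.

(** * Positions and residues in rotational words *)

Lemma mod_ordE (q k : nat) (i : 'I_q.+1) :
  (i%:Z == (k%:Z %% q.+1%:Z)%Z) = (i == inZp k).
Proof. by rewrite modz_nat -val_eqE. Qed.

Lemma flip_neq (p : nat) (X : word p) (k : int) (i : 'I_p) :
  (i%:Z == (k %% p%:Z)%Z) = false -> flip X k i = X i.
Proof. by move=> e; rewrite ffunE e. Qed.

Lemma flip_eq (p : nat) (X : word p) (k : int) (i : 'I_p) :
  i%:Z == (k %% p%:Z)%Z -> flip X k i = switch (X i).
Proof. by move=> e; rewrite ffunE e. Qed.

(** Multiplication by [m] and by [d] are inverse permutations of the residues modulo [p]. *)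
Lemma index_mulmodE (m d p j i : nat) :
  (m * d = 1 %[mod p])%N -> (i < p)%N -> (j < p)%N ->
  ((i * m) %% p == j)%N = (i == (j * d) %% p)%N.
Proof.
move=> md ip jp; apply/eqP/eqP => [<-|->]; rewrite modnMml -mulnA.
  by rewrite -modnMmr md modnMmr muln1 modn_small.
by rewrite -modnMmr [(d * m)%N]mulnC md modnMmr muln1 modn_small.
Qed.

(* In terms of the residues [i * m mod p], switching the letters at residues
   [0] and [ell] moves the block of [L]s from [0 .. ell-1] to [1 .. ell], and
   switching those at [ell-1] and [p-1] moves it to [-1 .. ell-2]. *)
Lemma rotational_flip_flip (ell m d q j : nat) :
  (0 < ell < q.+1)%N -> (m * d = 1 %[mod q.+1])%N ->
  j \in [:: 0; ell - 1; ell; q.+1 - 1]%N ->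
  exists (j' : nat) (s : 'I_q.+1),
    inZp (j' * d) != inZp (j * d) :> 'I_q.+1 /\
    flip (flip (rotational_word ell m q.+1) (j * d)%N%:Z) (j' * d)%N%:Z
    = shift (rotational_word ell m q.+1) s.
Proof.
move=> /andP[l0 lp] md hj.
have jp : (j < q.+1)%N by move: hj; rewrite !inE => /or4P[] /eqP ->; lia.
(* [j'] is the residue to be switched together with [j]. Reading the word at residue [u + r] instead
   of [u] moves the block of [L]s up by one for [r = q], which is -1 modulo [q.+1], and down by one
   for [r = 1]. *)
have [j' [r [j'p rp jj' hjr]]] : exists j' r, [/\ (j' < q.+1)%N, (r < q.+1)%N,
    j <> j' & (r = q /\ (j = 0 /\ j' = ell \/ j = ell /\ j' = 0)%N) \/
    (r = 1 /\ (j = ell - 1 /\ j' = q \/ j = q /\ j' = ell - 1)%N)%N].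
  move: hj; rewrite !inE => /or4P[] /eqP ->.
  - by exists ell, q; split; lia.
  - by exists q, 1%N; split; lia.
  - by exists 0%N, q; split; lia.
  - have [->|?] := eqVneq ell q; first by exists 0%N, q; split; lia.
    by exists (ell - 1)%N, 1%N; split; lia.
(* Advancing [r * d] places adds [r] to the residue, because [m * d] is 1 modulo [q.+1]. *)
exists j', (inZp (r * d)); split.
  rewrite -val_eqE /= eq_sym -(@index_mulmodE m d) ?ltn_mod //.
  rewrite modnMml -mulnA -modnMmr [(d * m)%N]mulnC md modnMmr muln1.
  by rewrite modn_small //; apply/eqP.
apply/ffunP => i; rewrite !ffunE !mod_ordE -!val_eqE /=.
rewrite -!(@index_mulmodE m d) //.
have -> : ((i + (r * d) %% q.+1) %% q.+1 * m
           = ((i * m) %% q.+1 + r) %[mod q.+1])%N.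
  rewrite modnMml mulnDl -modnDmr modnMml -[(r * d * m)%N]mulnA.
  by rewrite -modnMmr [(d * m)%N]mulnC md modnMmr muln1 modnDmr modnDml.
have := ltn_pmod (i * m) (ltn0Sn q); set u := (_ %% _)%N => up.
have [h|h] := ltnP (u + r) q.+1.
  rewrite modn_small //; do 4?[case: ifP => ?]; move=> //=; lia.
rewrite -(subnK h) modnDr modn_small; last lia.
do 4?[case: ifP => ?]; move=> //=; lia.
Qed.

(** * Signs of the first coordinates near the bifurcation *)

(** The sign of the first coordinate at an admissible point, so that one product treats both
    letters. *)
Definition letter_sign (R : realType) (s : letter) : R :=
  if s is symL then -1 else 1.

Lemma letter_sign_switch (R : realType) (s : letter) :
  letter_sign R (switch s) = - letter_sign R s.
Proof. by case: s; rewrite /= ?opprK. Qed.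

Lemma admissible_sign (R : realType) (n p : nat) (X : word p)
    (y : 'I_p -> 'cV[R]_n.+1) (i : 'I_p) :
  admissible X y -> 0 < letter_sign R (X i) * coord1 (y i).
Proof.
move=> /(_ i); case: (X i) => -[hL hR] /=; last by rewrite mul1r hR.
by rewrite mulN1r oppr_gt0 hL.
Qed.

Lemma virtual_sign (R : realType) (n p : nat) (X : word p)
    (y : 'I_p -> 'cV[R]_n.+1) :
  virtual X y -> exists i, letter_sign R (X i) * coord1 (y i) < 0.
Proof.
by move=> [i [] [e h]]; exists i; rewrite e /= ?mul1r // mulN1r oppr_lt0.
Qed.

#[local] Instance side_nbhs_proper (R : realType) (eta0 : R) (s : bif_side) :
  ProperFilter (side_nbhs eta0 s).
Proof.
by case: s; [exact: at_left_proper_filter|exact: at_right_proper_filter].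
Qed.

Lemma near_side_nbhs (R : realType) (eta0 : R) (s : bif_side) (P : set R) :
  (\forall eta \near eta0, P eta) ->
  \forall eta \near side_nbhs eta0 s, P eta.
Proof. by case: s => h; apply: cvg_within; exact: h. Qed.

(** A strictly wrong sign at [eta0] would persist nearby, also on the side where the cycle is
    admissible. *)
Lemma limit_cycle_sign (R : realType) (n q : nat)
    (AL AR : R -> 'M[R]_n.+1) (b : R -> 'cV[R]_n.+1) (X : word q.+1)
    (eta0 : R) (s : bif_side) (y : 'I_q.+1 -> 'cV[R]_n.+1) (i : 'I_q.+1) :
  mx_continuous AL -> mx_continuous AR -> mx_continuous b ->
  \det (1%:M - word_mx (AL eta0) (AR eta0) X) != 0 ->
  is_cycle (AL eta0) (AR eta0) (b eta0) X y ->
  admissible_exactly_on AL AR b eta0 X s ->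
  coord1 (y i) != 0 -> 0 < letter_sign R (X i) * coord1 (y i).
Proof.
move=> hL hR hb hdet hy [hadm _] y0; rewrite ltNge; apply/negP => hle.
have hneg : 0 < (- letter_sign R (X i)) * coord1 (y i).
  rewrite mulNr oppr_gt0 lt_neqAle hle andbT mulf_neq0 //.
  by case: (X i); rewrite /= ?oppr_eq0 oner_neq0.
have near_neg := near_side_nbhs s
  (cycle_coord1_sign_near hL hR hb hdet hy hneg).
have [eta [[w hw aw] /(_ w hw)]] := filter_ex (filterI hadm near_neg).
have := lt_trans (admissible_sign i aw).
by rewrite mulNr oppr_gt0 => h /h; rewrite ltxx.
Qed.

(** * Opposite determinants and the nonsmooth fold *)

Lemma switched_det_lt0 (R : realType) (n q : nat) (AL AR : 'M[R]_n.+1)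
    (b : 'cV[R]_n.+1) (X Y : word q.+1) (y : 'I_q.+1 -> 'cV[R]_n.+1)
    (k k' s : 'I_q.+1) :
  differ_only_in_first_column AL AR ->
  (forall i, i != k -> Y i = X i) ->
  k' != k -> (forall i, i != k' -> Y i = shift X s i) ->
  switch (Y k') = shift X s k' ->
  is_cycle AL AR b X y ->
  coord1 (y k) = 0 -> coord1 (y k') != 0 ->
  (forall i, coord1 (y i) != 0 -> 0 < letter_sign R (X i) * coord1 (y i)) ->
  \det (1%:M - word_mx AL AR X) != 0 -> \det (1%:M - word_mx AL AR Y) != 0 ->
  \det (1%:M - word_mx AL AR X) * \det (1%:M - word_mx AL AR Y) < 0.
Proof.
move=> hA hYX kk' hYs hk' hy yk yk' hsgn dX dY.
have hyY : is_cycle AL AR b Y y.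
  by apply: (cycle_switch hA _ yk hy) => i /hYX.
have := switched_cycles hA hYs hyY (cycle_shift s hy).
rewrite det_shift => e.
(* By [e] this coordinate is nonzero along with the one at [k'], so [hsgn] applies to both. *)
have yks : coord1 (y (k' + s)) != 0.
  apply/eqP => h; move: e; rewrite h mulr0 => /eqP.
  by rewrite mulf_eq0 (negPf dY) (negPf yk').
have := hsgn _ yks; have := hsgn _ yk'.
have -> : X (k' + s) = switch (X k') by rewrite -(hYX _ kk') hk' ffunE.
rewrite letter_sign_switch.
move: (letter_sign R _) e yk' yks dX dY => c.
set u := coord1 _; set v := coord1 _; set D := \det _; set D' := \det _.
move=> e u0 v0 D0 D'0 cu; rewrite mulNr oppr_gt0 => cv.
have uv : u * v < 0.
  have : (c * u) * (c * v) < 0 by rewrite pmulr_rlt0.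
  by rewrite mulrACA pmulr_rlt0 // -expr2 exprn_even_gt0 //=;
     apply: contraTneq cu => ->; rewrite mul0r ltxx.
(* Multiplying [e] by [D' * v] gives a nonzero square, so [D' * D] has the sign of [u * v]. *)
have : (u * v) * (D' * D) = (D' * v) ^+ 2 by rewrite expr2 -{1}e; ring.
move/(congr1 (fun x => 0 < x)); rewrite nmulr_rgt0 // => ->.
by rewrite exprn_even_gt0 //= mulf_neq0.
Qed.

Theorem theorem5p1 (R : realType) (n : nat)
    (AL AR : R -> 'M[R]_n.+1) (b : R -> 'cV[R]_n.+1)
    (cont_AL : continuous AL) (cont_AR : continuous AR) (cont_b : continuous b)
    (hcol : forall eta : R, differ_only_in_first_column (AL eta) (AR eta))
    (ell m p : nat)
    (ell_gt0 : (0 < ell)%N) (ell_ltp : (ell < p)%N)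
    (m_gt0 : (0 < m)%N) (m_ltp : (m < p)%N) (m_coprime : coprime m p)
    (d : nat) (d_gt0 : (0 < d)%N) (d_ltp : (d < p)%N)
    (d_inv : ((m * d) %% p)%N = 1%N)
    (j : nat) (hj : j \in [:: 0; ell - 1; ell; p - 1]%N)
    (k : int) (hk : k = (j * d)%N%:Z)
    (X : word p) (hX : X = rotational_word ell m p)
    (eta0 : R)
    (hbcb : undergoes_BCB AL AR b eta0 X k)
    (hgen : generic_BCB AL AR b eta0 X k) :
  nonsmooth_fold AL AR b eta0 X k.
Proof.
case: p ell_ltp m_ltp m_coprime d_ltp d_inv hj X hX hbcb hgen => // q.
move=> ell_ltp _ _ d_ltp d_inv hj X hX [y hy hy0] [dX dY _ [s hs] [s' hs']].
have hL := continuous_mx_continuous cont_AL.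
have hR := continuous_mx_continuous cont_AR.
have hb := continuous_mx_continuous cont_b.
have p_gt1 : (1 < q.+1)%N := leq_ltn_trans d_gt0 d_ltp.
have md : (m * d = 1 %[mod q.+1])%N by rewrite d_inv modn_small.
have [|j' [t [jj' eXt]]] := @rotational_flip_flip ell m d q j _ md hj.
  by rewrite ell_gt0.
pose Y := flip X k; rewrite -/Y in dY hs'.
pose k0 : 'I_q.+1 := inZp (j * d); pose k1 : 'I_q.+1 := inZp (j' * d).
have yE i : (coord1 (y i) == 0) = (i == k0).
  by rewrite -mod_ordE -hk; apply/eqP/eqP => /hy0.
have YX i : i != k0 -> Y i = X i.
  by rewrite -mod_ordE -hk => /negPf; exact: flip_neq.
have Yk : Y k0 = switch (X k0) by apply: flip_eq; rewrite hk mod_ordE.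
have hsgn i : coord1 (y i) != 0 -> 0 < letter_sign R (X i) * coord1 (y i).
  exact: limit_cycle_sign hs.
have shiftE : flip Y (j' * d)%N%:Z = shift X t by rewrite /Y hk hX.
have DD : \det (1%:M - word_mx (AL eta0) (AR eta0) X)
          * \det (1%:M - word_mx (AL eta0) (AR eta0) Y) < 0.
  apply: (@switched_det_lt0 _ _ _ _ _ (b eta0) X Y y k0 k1 t (hcol eta0) YX
            jj' _ _ hy) => //.
  - by move=> i; rewrite -shiftE -mod_ordE => /negPf /flip_neq ->.
  - by rewrite -shiftE flip_eq // mod_ordE.
  - by apply/eqP; rewrite yE.
  - by rewrite yE.
have nearDD : \forall eta \near eta0,
    \det (1%:M - word_mx (AL eta) (AR eta) X)
    * \det (1%:M - word_mx (AL eta) (AR eta) Y) < 0.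
  have cD (Z : word q.+1) := @continuous_word_det _ _ _ _ _ Z hL hR eta0.
  exact: cvgr_lt (cvgM (cD X) (cD Y)) _ DD.
have yY : is_cycle (AL eta0) (AR eta0) (b eta0) Y y.
  apply: (cycle_switch (hcol eta0) _ _ hy) => [i /YX //|].
  by apply/eqP; rewrite yE.
(* Away from [k0] a [Y]-cycle keeps the signs of [y], which are right for [Y]; near [eta0] it can be
   virtual only through its point at [k0]. *)
have nearY : \forall eta \near eta0, forall i : 'I_q.+1, i != k0 -> forall w,
    is_cycle (AL eta) (AR eta) (b eta) Y w ->
    0 < letter_sign R (Y i) * coord1 (w i).
  suff near_i (i : 'I_q.+1) : \forall eta \near eta0, i != k0 -> forall w,
      is_cycle (AL eta) (AR eta) (b eta) Y w ->
      0 < letter_sign R (Y i) * coord1 (w i) by exact: (filter_forall _ near_i).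
  have [->|ik] := eqVneq i k0.
    by apply: (@filterE _ (nbhs eta0)) => eta /eqP.
  have yi : 0 < letter_sign R (Y i) * coord1 (y i).
    by rewrite YX //; apply: hsgn; rewrite yE.
  by apply: filterS (cycle_coord1_sign_near hL hR hb dY yY yi) => eta h _.
(* Otherwise, on side [s], the [X]-cycle is admissible and the [Y]-cycle virtual, which is refuted
   below. *)
have [ss'|ss'] : s' = s \/ s' = opposite s.
  by case: s s' {hs hs'} => [] []; auto.
  by exists s; split => //; rewrite -ss'.
have [hadm _] := hs; have [_] := hs'; rewrite ss'.
have -> : opposite (opposite s) = s by case: (s).
move=> hvir.
have [eta [[[u hu au] [w hw /virtual_sign [i wi]]] [D0 /(_ i)]]] :=
  filter_ex (filterI (filterI hadm hvir)
    (filterI (near_side_nbhs s nearDD) (near_side_nbhs s nearY))).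
have [ik _|ik /(_ isT w hw) h] := eqVneq i k0; last first.
  by have := lt_trans h wi; rewrite ltxx.
have e := switched_cycles (hcol eta) (fun i h => esym (YX i h)) hu hw.
have := admissible_sign k0 au; move: wi; rewrite {}ik Yk letter_sign_switch.
move: (letter_sign R _) e D0 => c.
set x := coord1 _; set z := coord1 _; set D := \det _; set D' := \det _.
move=> e D0; rewrite mulNr oppr_lt0 => cz cx.
(* [X] and [Y] have opposite letters at [k0], so the right sign for [X] and the wrong sign for [Y]
   coincide. *)
have xz : 0 < x * z.
  have := mulr_gt0 cx cz; rewrite mulrACA pmulr_rgt0 // -expr2.
  by rewrite exprn_even_gt0 //=; apply: contraTneq cz => ->; rewrite mul0r ltxx.
(* The square forces [0 <= D * D'], against [D0]. *)
have : (x * z) * (D * D') = (D' * z) ^+ 2 by rewrite expr2 -{1}e; ring.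
move/(congr1 (fun x => 0 <= x)); rewrite sqr_ge0 pmulr_rge0 // => DD0.
by move: D0; rewrite ltNge DD0.
Qed.
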